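(* Let $N\ge1$ and $a_1,\dots,a_N>0$. Let $x^{(n)}_k(t)$, $1\le k\le n\le N$, be the alpha-case law-of-large-numbers limits defined in the context, with $t\ge0$ an integer and $\alpha_1,\dots,\alpha_t>0$ such that $a_i\alpha_j<1$ for all $i,j$. Then for $1\le r\le n\le N$ $$e^{-(x^{(n)}_n(t)+\cdots+x^{(n)}_{n-r+1}(t))}=\det\big[A(i-j)\big]_{i,j=1}^r=(-1)^{r(r+1)/2}\det\big[\tilde A_{i,j}\big]_{i,j=1}^r,$$ where $$A(s)=\frac{-1}{2\pi\mathrm{i}}\oint z^s\prod_{\ell=1}^n\frac{a_\ell}{a_\ell-z}\,\prod_{m=1}^t(1-\alpha_mz)\,\frac{dz}{z},$$ with the integral along a (counterclockwise simple) contour containing $a_1,\dots,a_N$ but not $0$, and $$\tilde A_{i,j}=\frac1{2\pi\mathrm{i}}\oint p_{i-1}(z)p_{j-1}(z)\prod_{\ell=1}^n\frac{a_\ell}{a_\ell-z}\,\prod_{m=1}^t(1-\alpha_mz)\,\frac{dz}{z^r},$$ where $p_j(z)$ is any monic polynomial of degree $j$ (for each $j\ge 0$) and the contour is the same. In the Plancherel case, the same formulas hold with $x^{(n)}_k(\tau)$ in place of $x^{(n)}_k(t)$ and with $\prod_{m=1}^t(1-\alpha_mz)$ replaced by $e^{-\tau z}$ in the definitions of $A(s)$ and $\tilde A_{i,j}$.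
   Context: The limits $x^{(n)}_k$ are determined by the formulas, for $1\le r\le n\le N$, $$e^{-(x^{(n)}_n+\cdots+x^{(n)}_{n-r+1})}=\oint\cdots\oint\frac{(-1)^{\frac{r(r+1)}2}\prod_{1\le k<\ell\le r}(z_k-z_\ell)^2}{(2\pi\mathrm{i})^r\,r!\,\prod_{k=1}^r(z_k)^r}\ \prod_{k=1}^r\bigg(\prod_{\ell=1}^n\frac{a_\ell}{a_\ell-z_k}\bigg)w(z_k)\ dz_1\cdots dz_r,$$ with integration along counterclockwise simple loops enclosing $a_1,\dots,a_n$ but not $0$, where $w(z)=\prod_{i=1}^t(1-\alpha_iz)$ for $x^{(n)}_k=x^{(n)}_k(t)$ (alpha case) and $w(z)=e^{-\tau z}$, $\tau>0$, for $x^{(n)}_k=x^{(n)}_k(\tau)$ (Plancherel case). *)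

(* Defs.v *)
From mathcomp Require Import all_boot all_order all_algebra.
From mathcomp Require Import all_classical all_reals all_analysis.
From mathcomp Require Import complex.

Set Implicit Arguments.
Unset Strict Implicit.
Unset Printing Implicit Defensive.

Import Order.TTheory GRing.Theory Num.Theory.
Import numFieldNormedType.Exports.

Local Open Scope classical_set_scope.
Local Open Scope ring_scope.

(* Indices l, m, n, k of the families a, alpha, x are 1-based naturals, as in
   the text; values outside the stated ranges are never used. *)

Definition cexp (R : realType) (z : R[i]) : R[i] :=
  Complex (expR (complex.Re z) * cos (complex.Im z))
          (expR (complex.Re z) * sin (complex.Im z)).

Definition two_pi_i (R : realType) : R[i] := Complex 0 (2 * pi).

(* The speed of a parametrized curve; at a corner of a piecewise C^1 curve the
   value is meaningless, which does not affect the integrals below. *)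
Definition speed (R : realType) (c : R -> R[i]) (u : R) : R[i] :=
  Complex (derive1 (fun v => complex.Re (c v)) u)
          (derive1 (fun v => complex.Im (c v)) u).

Definition contour_int (R : realType) (c : R -> R[i]) (f : R[i] -> R[i])
    : R[i] :=
  Complex
    (\int[lebesgue_measure]_(u in `[0, 1]) complex.Re (f (c u) * speed c u))
    (\int[lebesgue_measure]_(u in `[0, 1]) complex.Im (f (c u) * speed c u)).

(* The variables z_1, ..., z_r of the integrand are the entries of a list of
   length r; the k-th one runs over the k-th curve of the list cs. *)
Fixpoint iter_contour_int (R : realType) (cs : seq (R -> R[i]))
    (F : seq R[i] -> R[i]) : R[i] :=
  if cs is c :: cs' then
    contour_int c (fun z => iter_contour_int cs' (fun zs => F (z :: zs)))
  else F [::].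

(* C^1 up to the endpoints: f is continuous on [u, v], differentiable inside,
   and its derivative extends continuously to [u, v]. *)
Definition C1_on (R : realType) (f : R -> R) (u v : R) : Prop :=
  derivable_oo_LRcontinuous f u v /\
  exists2 g : R -> R, {within `[u, v], continuous g}
                    & {in `]u, v[, derive1 f =1 g}.

Definition piecewise_C1 (R : realType) (c : R -> R[i]) : Prop :=
  exists2 s : seq R, itv_partition 0 1 s &
    forall k, (k < size s)%N ->
      C1_on (fun u => complex.Re (c u)) (nth 0 (0 :: s) k) (nth 0 s k) /\
      C1_on (fun u => complex.Im (c u)) (nth 0 (0 :: s) k) (nth 0 s k).

Definition simple_loop (R : realType) (c : R -> R[i]) : Prop :=
  [/\ piecewise_C1 c, c 0 = c 1 & {in `[0, 1[ &, injective c}].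

Definition avoids (R : realType) (c : R -> R[i]) (p : R[i]) : Prop :=
  forall u, u \in `[0, 1] -> c u != p.

Definition winding_number (R : realType) (c : R -> R[i]) (p : R[i]) : R[i] :=
  (two_pi_i R)^-1 * contour_int c (fun z => (z - p)^-1).

(* A point off a simple loop lies in its interior, the loop being run
   counterclockwise, iff the winding number is 1, and lies outside iff the
   winding number is 0. *)
Definition ccw_loop_around (R : realType) (n : nat) (a : nat -> R)
    (c : R -> R[i]) : Prop :=
  [/\ simple_loop c,
      forall l, (1 <= l <= n)%N ->
        avoids c (a l)%:C%C /\ winding_number c (a l)%:C%C = 1
    & avoids c 0 /\ winding_number c 0 = 0].

Definition a_factor (R : realType) (n : nat) (a : nat -> R) (z : R[i]) : R[i] :=
  \prod_(1 <= l < n.+1) ((a l)%:C%C / ((a l)%:C%C - z)).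

Definition w_alpha (R : realType) (t : nat) (alpha : nat -> R) (z : R[i])
    : R[i] :=
  \prod_(1 <= m < t.+1) (1 - (alpha m)%:C%C * z).

Definition w_plancherel (R : realType) (tau : R) (z : R[i]) : R[i] :=
  cexp (- (tau%:C%C * z)).

Definition lln_integrand (R : realType) (n r : nat) (a : nat -> R)
    (w : R[i] -> R[i]) (z : seq R[i]) : R[i] :=
  (-1) ^+ (r * r.+1)./2
    * (\prod_(k < r) \prod_(l < r | (k < l)%N) (z`_k - z`_l) ^+ 2)
    / ((two_pi_i R) ^+ r * r`!%:R * \prod_(k < r) z`_k ^+ r)
    * \prod_(k < r) (a_factor n a z`_k * w z`_k).

(* x^(n)_n + ... + x^(n)_{n-r+1}, for r <= n *)
Definition top_sum (R : realType) (x : nat -> nat -> R) (n r : nat) : R :=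
  \sum_((n - r).+1 <= k < n.+1) x n k.

(* x n k stands for x^(n)_k.  By Cauchy's theorem the multiple integral does
   not depend on the loops, so the formula is only required for some choice of
   r admissible loops, possibly depending on n and r. *)
Definition lln_limits (R : realType) (N : nat) (a : nat -> R)
    (w : R[i] -> R[i]) (x : nat -> nat -> R) : Prop :=
  forall n r, (1 <= r <= n)%N -> (n <= N)%N ->
    exists cs : seq (R -> R[i]),
      [/\ size cs = r,
          forall k, (k < r)%N -> ccw_loop_around n a (nth (fun=> 0) cs k)
        & (expR (- top_sum x n r))%:C%C
          = iter_contour_int cs (lln_integrand n r a w)].

Definition A_entry (R : realType) (n : nat) (a : nat -> R) (w : R[i] -> R[i])
    (c : R -> R[i]) (s : int) : R[i] :=
  (-1) / two_pi_i R
    * contour_int c (fun z => z ^ s * a_factor n a z * w z / z).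

(* i and j are 0-based here, so that p_{i-1} becomes p i. *)
Definition Atilde_entry (R : realType) (n r : nat) (a : nat -> R)
    (w : R[i] -> R[i]) (p : nat -> {poly R[i]}) (c : R -> R[i]) (i j : nat)
    : R[i] :=
  (two_pi_i R)^-1
    * contour_int c
        (fun z => (p i).[z] * (p j).[z] * a_factor n a z * w z / z ^+ r).

(* Main.v *)
Require Import Defs.
From mathcomp Require Import all_boot all_order all_algebra.
From mathcomp Require Import fingroup perm.
From mathcomp Require Import all_classical all_reals all_analysis.
From mathcomp Require Import measurable_realfun complex ring lra.

Set Implicit Arguments.
Unset Strict Implicit.
Unset Printing Implicit Defensive.

Import Order.TTheory GRing.Theory Num.Theory.
Import numFieldNormedType.Exports.

Local Open Scope ring_scope.

(** The theorem combines one fact of complex analysis with one of linear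
    algebra.

    Analysis.  All integrands are of the form
    [Q(z) W(z) exp(- tau z) / (z ^ r (z - a_1) ... (z - a_n))] with polynomials
    [Q] and [W]; the alpha case has [tau = 0].  The integral of such a function
    along a closed curve depends on the curve only through its winding numbers
    around [0, a_1, ..., a_n], so that every admissible loop gives the same
    value ([same_contour_int_kernel]).  Partial fractions reduce this to the
    functions [exp(- tau z) z ^ m] and [exp(- tau z) / (z - p) ^ m]
    ([pfrac_rational]).  Integrating exact derivatives lowers the exponents
    ([same_contour_int_expX], [same_contour_int_expV]) until only the simple
    pole is left.  For that one, the integral of
    [exp(- tau (z - p)) / (z - p)] does not depend on [tau], since its
    derivative in [tau] is the integral of [- exp(- tau (z - p))], which
    vanishes because that function has a primitive ([expN_kernel_int]); at
    [tau = 0] it is [2 pi i] times the winding number.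

    Algebra.  Write [m_k] for [1 / (2 pi i)] times the integral of
    [z ^ k W(z) exp(- tau z) / z ^ r] against the product of the factors
    [a_l / (a_l - z)].  The product of the [(z_k - z_l) ^ 2] is the square of a
    Vandermonde determinant; expanding both factors over permutations turns the
    multiple integral into products of single integrals, whose sum is
    [r! det [m_(i + j)]] (Andreief's identity, [sum_perm_pair]).  Hence the left
    hand side is [(-1) ^ (r (r + 1) / 2) det [m_(i + j)]] ([lln_expand]).
    Reversing the order of the columns and changing the sign of each one turns
    the Hankel matrix [m_(i + j)] into the Toeplitz matrix [A(i - j)]
    ([det_A]), and passing from the monomials to the monic polynomials [p_j]
    multiplies it on both sides by unitriangular matrices ([det_Atilde]). *)

(** * Piecewise integration on the real line *)

Section IntegrableUnion.
Local Open Scope classical_set_scope.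
Local Open Scope ring_scope.

Lemma integrable_disjU d (T : measurableType d) (R : realType)
    (mu : {measure set T -> \bar R}) (A B : set T) (f : T -> \bar R) :
  measurable A -> measurable B -> [disjoint A & B] ->
  mu.-integrable A f -> mu.-integrable B f -> mu.-integrable (A `|` B) f.
Proof.
move=> mA mB AB /integrableP[mfA fA] /integrableP[mfB fB].
have mU : measurable_fun (A `|` B) f by exact/measurable_funU.
apply/integrableP; split=> //.
rewrite ge0_integral_setU//; first exact: lte_add_pinfty.
exact: measurableT_comp.
Qed.

End IntegrableUnion.

Section RealPieces.
Local Open Scope classical_set_scope.
Local Open Scope ring_scope.
Variable R : realType.
Local Notation mu := (@lebesgue_measure R).
Implicit Types (P Q : R -> R -> Prop) (f g F : R -> R) (x y z a b : R).

(** Integrability and the fundamental theorem of calculus pass from the smooth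
    pieces of a curve to its whole parameter interval by this induction. *)
Lemma itv_partition_elim P Q :
    (forall x, Q x x) ->
    (forall x y z, x < y -> y <= z -> P x y -> Q y z -> Q x z) ->
  forall s a b, itv_partition a b s ->
    (forall k, (k < size s)%N -> P (nth 0 (a :: s) k) (nth 0 s k)) ->
  Q a b.
Proof.
move=> Qxx Qstep; elim=> [|x s IH] a b.
  by move=> /itv_partition_nil -> _.
move=> abs Ps; have sx := itv_partition_cons abs.
have ax : a < x by case: abs => /= /andP[].
apply: (Qstep a x b) => //.
- by have := itv_partition_le sx.
- exact: (Ps 0%N).
- by apply: IH => // k ks; exact: (Ps k.+1).
Qed.

Lemma subitv_oo_cc x y : `]x, y[%classic `<=` `[x, y]%classic.
Proof. by move=> u /=; rewrite !in_itv/= => /andP[*]; rewrite !ltW. Qed.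

Lemma subitv_co_cc x y : `[x, y[%classic `<=` `[x, y]%classic.
Proof. by move=> u /=; rewrite !in_itv/= => /andP[-> *]; rewrite ltW. Qed.

Lemma subitv_oc_cc x y : `]x, y]%classic `<=` `[x, y]%classic.
Proof. by move=> u /=; rewrite !in_itv/= => /andP[? ->]; rewrite ltW. Qed.

(** The end points form a null set, which is why the value of the speed of a
    curve at a corner is harmless. *)
Lemma integrable_eq_interior f g x y : x < y ->
  {within `[x, y], continuous g} -> {in `]x, y[, f =1 g} ->
  mu.-integrable `[x, y] (EFin \o f).
Proof.
move=> xy cg fg.
have ig : mu.-integrable `[x, y] (EFin \o g).
  by apply: continuous_compact_integrable => //; exact: segment_compact.
have ioo : mu.-integrable `]x, y[ (EFin \o f).
  apply: (@eq_integrable _ _ _ mu _ _ (EFin \o g)) => //.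
    by move=> u; rewrite inE => /fg /= ->.
  by apply: integrableS ig => //; exact: subitv_oo_cc.
have [mf foo] := integrableP _ _ _ ioo.
have mf' := (emeasurable_fun_itv_obnd_cbndP _ _ _).1 mf.
apply/integrableP; split; first exact/emeasurable_fun_itv_bndo_bndcP.
rewrite -integral_itv_bndo_bndc; last by apply: measurableT_comp.
by rewrite -integral_itv_obnd_cbnd//; apply: measurableT_comp.
Qed.

Lemma integrable_cat f x y z : x <= y -> y <= z ->
  mu.-integrable `[x, y] (EFin \o f) -> mu.-integrable `[y, z] (EFin \o f) ->
  mu.-integrable `[x, z] (EFin \o f).
Proof.
move=> xy yz ixy iyz.
have -> : `[x, z]%classic = `[x, y] `|` `]y, z] :> set R.
  apply/seteqP; split=> u /=; rewrite !in_itv/=.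
    by case: (leP u y) => [uy /andP[-> _]|uy /andP[_ ->]]; [left|right].
  move=> [/andP[-> uy]|/andP[yu ->]] /=; first by rewrite (le_trans uy).
  by rewrite andbT (le_trans xy)// ltW.
have {}iyz : mu.-integrable `]y, z] (EFin \o f).
  by apply: integrableS iyz => //; exact: subitv_oc_cc.
apply: integrable_disjU => //.
rewrite disj_set2E; apply/eqP/seteqP; split=> // u [] /=.
by rewrite !in_itv/= => /andP[_ uy] /andP[]; rewrite ltNge uy.
Qed.

Lemma Rintegral_cat f x y z : x <= y -> y <= z ->
  mu.-integrable `[x, y] (EFin \o f) -> mu.-integrable `[y, z] (EFin \o f) ->
  \int[mu]_(u in `[x, z]) f u
    = \int[mu]_(u in `[x, y]) f u + \int[mu]_(u in `[y, z]) f u.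
Proof.
move=> xy yz ixy iyz.
have := Rintegral_itvB (integrable_cat xy yz ixy iyz) (x := y).
rewrite !bnd_simp => /(_ xy yz).
rewrite Rintegral_itv_obnd_cbnd; last first.
  by apply: integrableS iyz => //; exact: subitv_oc_cc.
by move=> <-; rewrite addrC subrK.
Qed.

(** Nothing is asked of [f] at the end points, because the speed of a curve has
    no meaning at its corners. *)
Lemma Rintegral_FTC f g F x y : x < y ->
  {within `[x, y], continuous g} -> {in `]x, y[, f =1 g} ->
  {within `[x, y], continuous F} ->
  (forall u, u \in `]x, y[ -> is_derive u 1 F (f u)) ->
  \int[mu]_(u in `[x, y]) f u = F y - F x.
Proof.
move=> xy cg fg cF dF.
have iF := integrable_eq_interior xy cg fg.
have ig := integrable_eq_interior xy cg (fun _ _ => erefl).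
have oo h : mu.-integrable `[x, y] (EFin \o h) ->
    \int[mu]_(u in `[x, y]) h u = \int[mu]_(u in `]x, y[) h u.
  move=> ih; rewrite -Rintegral_itv_bndo_bndc; last first.
    by apply: integrableS ih => //; exact: subitv_co_cc.
  rewrite Rintegral_itv_obnd_cbnd//.
  by apply: integrableS ih => //; exact: subitv_oo_cc.
have -> : \int[mu]_(u in `[x, y]) f u = \int[mu]_(u in `[x, y]) g u.
  by rewrite !oo//; apply: eq_Rintegral => u; rewrite inE => /fg.
rewrite /Rintegral (continuous_FTC2 xy cg (F := F))//.
- split; [|by case/(continuous_within_itvP _ xy): cF..].
  by move=> u /dF du; exact: ex_derive.
- move=> u uxy; rewrite -fg// derive1E.
  by have du := dF _ uxy; exact: derive_val.
Qed.

End RealPieces.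

(** * Continuity and derivatives of complex curves, by components *)

Section ComplexCurves.
Local Open Scope classical_set_scope.
Local Open Scope ring_scope.
Variable R : realType.
Local Notation C := R[i].
Local Notation Re := (@complex.Re R).
Local Notation Im := (@complex.Im R).
Implicit Types (z w : C) (c : R -> C) (u x y : R) (A : set R).

Lemma complex_ReD z w : Re (z + w) = Re z + Re w.
Proof. by case: z; case: w. Qed.

Lemma complex_ImD z w : Im (z + w) = Im z + Im w.
Proof. by case: z; case: w. Qed.

Lemma complex_ReM z w : Re (z * w) = Re z * Re w - Im z * Im w.
Proof. by case: z; case: w. Qed.

Lemma complex_ImM z w : Im (z * w) = Re z * Im w + Im z * Re w.
Proof. by case: z; case: w. Qed.

Definition sqmod z : R := Re z * Re z + Im z * Im z.

Lemma complex_ReV z : Re z^-1 = Re z * (sqmod z)^-1.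
Proof. by case: z => a b; rewrite /sqmod -!expr2. Qed.

Lemma complex_ImV z : Im z^-1 = - Im z * (sqmod z)^-1.
Proof. by case: z => a b; rewrite /sqmod -!expr2 mulNr. Qed.

Lemma complex_ext z w : Re z = Re w -> Im z = Im w -> z = w.
Proof. by case: z => a b; case: w => a' b' /= -> ->. Qed.

Lemma sqmod_eq0 z : (sqmod z == 0) = (z == 0).
Proof.
rewrite /sqmod -!expr2 paddr_eq0 ?sqr_ge0// !sqrf_eq0.
by case: z => a b; rewrite eq_complex.
Qed.

Definition curve_continuous A c :=
  {within A, continuous (Re \o c)} /\ {within A, continuous (Im \o c)}.

Lemma curve_continuousP A c : curve_continuous A c <-> forall u, A u ->
  Re (c v) @[v --> within A (nbhs u)] --> Re (c u) /\
  Im (c v) @[v --> within A (nbhs u)] --> Im (c u).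
Proof.
split=> [[/subspace_continuousP cr /subspace_continuousP ci] u Au|h].
  by split; [exact: cr|exact: ci].
by split; apply/subspace_continuousP => u /h [].
Qed.

Lemma curve_continuous_cst A z : curve_continuous A (fun=> z).
Proof. by apply/curve_continuousP => u Au; split; exact: cvg_cst. Qed.

Lemma curve_continuousD A c d : curve_continuous A c ->
  curve_continuous A d -> curve_continuous A (fun u => c u + d u).
Proof.
move=> /curve_continuousP cc /curve_continuousP cd.
apply/curve_continuousP => u Au.
have [c1 c2] := cc u Au; have [d1 d2] := cd u Au.
split; [under eq_fun do rewrite complex_ReD
      |under eq_fun do rewrite complex_ImD];
  rewrite ?complex_ReD ?complex_ImD; exact: cvgD.
Qed.

Lemma curve_continuousM A c d : curve_continuous A c ->
  curve_continuous A d -> curve_continuous A (fun u => c u * d u).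
Proof.
move=> /curve_continuousP cc /curve_continuousP cd.
apply/curve_continuousP => u Au.
have [c1 c2] := cc u Au; have [d1 d2] := cd u Au.
split; [under eq_fun do rewrite complex_ReM
      |under eq_fun do rewrite complex_ImM];
  rewrite ?complex_ReM ?complex_ImM; [apply: cvgB|apply: cvgD]; exact: cvgM.
Qed.

Lemma curve_continuousV A c : curve_continuous A c ->
  (forall u, A u -> c u != 0) ->
  curve_continuous A (fun u => (c u)^-1).
Proof.
move=> /curve_continuousP cc cN0; apply/curve_continuousP => u Au.
have [c1 c2] := cc u Au.
have cn : (sqmod (c v))^-1 @[v --> within A (nbhs u)] --> (sqmod (c u))^-1.
  apply: cvgV; first by rewrite sqmod_eq0 cN0.
  by apply: cvgD; exact: cvgM.
split; [under eq_fun do rewrite complex_ReV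
      |under eq_fun do rewrite complex_ImV];
  rewrite ?complex_ReV ?complex_ImV; apply: cvgM => //; exact: cvgN.
Qed.

Lemma curve_continuous_cexp A c : curve_continuous A c ->
  curve_continuous A (fun u => cexp (c u)).
Proof.
move=> /curve_continuousP cc; apply/curve_continuousP => u Au.
have [c1 c2] := cc u Au.
split=> /=; apply: cvgM.
- exact: (continuous_cvg _ (@continuous_expR _ _) c1).
- exact: (continuous_cvg _ (@continuous_cos _ _) c2).
- exact: (continuous_cvg _ (@continuous_expR _ _) c1).
- exact: (continuous_cvg _ (@continuous_sin _ _) c2).
Qed.

Definition curve_deriv c u z :=
  is_derive u 1 (Re \o c) (Re z) /\ is_derive u 1 (Im \o c) (Im z).

(** Complex differentiability tested along curves: [F] carries every curve
    through [z] that is differentiable there to a differentiable curve, and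
    multiplies its velocity by [w].  The chain rule needed for contour integrals
    thus holds by definition. *)
Definition complex_deriv_at (F : C -> C) z w :=
  forall c u d, c u = z -> curve_deriv c u d -> curve_deriv (F \o c) u (w * d).

Lemma complex_deriv_cst k z : complex_deriv_at (fun=> k) z 0.
Proof. by move=> c u d _ _; rewrite mul0r; split; exact: is_derive_cst. Qed.

Lemma complex_deriv_id z : complex_deriv_at id z 1.
Proof. by move=> c u d _; rewrite mul1r. Qed.

Lemma complex_derivD F G z F' G' : complex_deriv_at F z F' ->
  complex_deriv_at G z G' -> complex_deriv_at (fun z => F z + G z) z (F' + G').
Proof.
move=> dF dG c u d cu cd.
have [F1 F2] := dF c u d cu cd; have [G1 G2] := dG c u d cu cd.
rewrite mulrDl; split.
- rewrite (_ : _ \o _ = (fun v => Re (F (c v)) : R)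
                        + (fun v => Re (G (c v)) : R)); last first.
    by apply/funext => v /=; rewrite complex_ReD.
  by rewrite complex_ReD; exact: is_deriveD.
- rewrite (_ : _ \o _ = (fun v => Im (F (c v)) : R)
                        + (fun v => Im (G (c v)) : R)); last first.
    by apply/funext => v /=; rewrite complex_ImD.
  by rewrite complex_ImD; exact: is_deriveD.
Qed.

Lemma complex_derivM F G z F' G' : complex_deriv_at F z F' ->
  complex_deriv_at G z G' ->
  complex_deriv_at (fun z => F z * G z) z (F' * G z + F z * G').
Proof.
move=> dF dG c u d cu cd.
have [F1 F2] := dF c u d cu cd; have [G1 G2] := dG c u d cu cd.
pose reF := (fun v => Re (F (c v)) : R); pose imF := (fun v => Im (F (c v)) : R).
pose reG := (fun v => Re (G (c v)) : R); pose imG := (fun v => Im (G (c v)) : R).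
split.
- rewrite (_ : _ \o _ = reF * reG - imF * imG); last first.
    by apply/funext => v /=; rewrite complex_ReM.
  apply: is_derive_eq; rewrite /GRing.scale/= /reF /imF /reG /imG cu.
  by rewrite !(complex_ReM, complex_ImM, complex_ReD, complex_ImD); ring.
- rewrite (_ : _ \o _ = reF * imG + imF * reG); last first.
    by apply/funext => v /=; rewrite complex_ImM.
  apply: is_derive_eq; rewrite /GRing.scale/= /reF /imF /reG /imG cu.
  by rewrite !(complex_ReM, complex_ImM, complex_ReD, complex_ImD); ring.
Qed.

Lemma complex_derivV F z F' : F z != 0 -> complex_deriv_at F z F' ->
  complex_deriv_at (fun z => (F z)^-1) z (- F' / F z ^+ 2).
Proof.
move=> Fz dF c u d cu cd; have [F1 F2] := dF c u d cu cd.
have n0 : sqmod (F (c u)) != 0 by rewrite sqmod_eq0 cu.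
pose a := (fun v => Re (F (c v)) : R); pose b := (fun v => Im (F (c v)) : R).
have dn : is_derive u 1 (fun v => (sqmod (F (c v)))^-1)
    (- (sqmod (F (c u))) ^- 2 *:
      (a u *: Re (F' * d) + a u *: Re (F' * d)
       + (b u *: Im (F' * d) + b u *: Im (F' * d)))).
  apply: (@is_deriveV _ (a * a + b * b)) => //.
split.
- rewrite (_ : _ \o _ = a * (fun v => (sqmod (F (c v)))^-1)); last first.
    by apply/funext => v /=; rewrite complex_ReV.
  apply: is_derive_eq; rewrite /GRing.scale/= /a /b /= cu -{}cu.
  rewrite !(complex_ReM, complex_ImM, complex_ReD, complex_ImD).
  rewrite !(complex_ReV, complex_ImV) !(complex_ReM, complex_ImM).
  move: n0; rewrite expr2 invfM /sqmod; clear.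
  move: (F (c u)) F' d => [p q] [r s] [e f] /= n0; field.
  (* The other denominator is the squared modulus of the square. *)
  by rewrite [X in X != 0](_ : _ = (p * p + q * q) ^+ 2) ?expf_neq0 ?n0//; ring.
- pose b' := (fun v => - Im (F (c v)) : R).
  have db' : is_derive u 1 b' (- Im (F' * d)) by exact: is_deriveN.
  rewrite (_ : _ \o _ = b' * (fun v => (sqmod (F (c v)))^-1)); last first.
    by apply/funext => v /=; rewrite complex_ImV.
  apply: is_derive_eq; rewrite /GRing.scale/= /a /b /b' /= cu -{}cu.
  rewrite !(complex_ReM, complex_ImM, complex_ReD, complex_ImD).
  rewrite !(complex_ReV, complex_ImV) !(complex_ReM, complex_ImM).
  move: n0; rewrite expr2 invfM /sqmod; clear.
  move: (F (c u)) F' d => [p q] [r s] [e f] /= n0; field.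
  (* The other denominator is the squared modulus of the square. *)
  by rewrite [X in X != 0](_ : _ = (p * p + q * q) ^+ 2) ?expf_neq0 ?n0//; ring.
Qed.

Lemma complex_deriv_cexp F z F' : complex_deriv_at F z F' ->
  complex_deriv_at (fun z => cexp (F z)) z (F' * cexp (F z)).
Proof.
move=> dF c u d cu cd; have [F1 F2] := dF c u d cu cd.
pose a := (fun v => Re (F (c v)) : R); pose b := (fun v => Im (F (c v)) : R).
split.
- rewrite (_ : _ \o _ = (expR \o a) * (cos \o b)); last exact/funext.
  apply: is_derive_eq; rewrite /GRing.scale/= /a /b cu.
  by rewrite !(complex_ReM, complex_ImM)/=; ring.
- rewrite (_ : _ \o _ = (expR \o a) * (sin \o b)); last exact/funext.
  apply: is_derive_eq; rewrite /GRing.scale/= /a /b cu.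
  by rewrite !(complex_ReM, complex_ImM)/=; ring.
Qed.

Lemma complex_deriv_eq F z w w' : complex_deriv_at F z w -> w = w' ->
  complex_deriv_at F z w'.
Proof. by move=> h <-. Qed.

Lemma complex_derivX F z F' n : complex_deriv_at F z F' ->
  complex_deriv_at (fun z => F z ^+ n) z (n%:R * F z ^+ n.-1 * F').
Proof.
move=> dF; elim: n => [|n IH].
  rewrite (_ : (fun _ => _) = fun=> 1); last by apply/funext.
  by apply: complex_deriv_eq (@complex_deriv_cst _ _) _; rewrite !mul0r.
rewrite (_ : (fun _ => _) = fun z => F z * F z ^+ n); last first.
  by apply/funext => v; rewrite exprS.
apply: complex_deriv_eq (complex_derivM dF IH) _.
case: n {IH} => [|n] /=; first by rewrite !expr0; ring.
by rewrite -[in RHS]natr1 exprS; ring.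
Qed.

End ComplexCurves.

(** * Contour integrals along piecewise smooth curves *)

Section ContourIntegrals.
Local Open Scope classical_set_scope.
Local Open Scope ring_scope.
Variable R : realType.
Local Notation mu := (@lebesgue_measure R).
Local Notation C := R[i].
Local Notation Re := (@complex.Re R).
Local Notation Im := (@complex.Im R).
Implicit Types (z w k : C) (c : R -> C) (f g F : C -> C).
Implicit Types (u x y : R) (A : set R).

(** Continuity of [f] on the image of the curve, stated on every part of the
    parameter interval where the curve is known to be continuous, so that it can
    be applied on each smooth piece. *)
Definition continuous_along c f :=
  forall A, A `<=` `[0, 1] ->
    curve_continuous A c -> curve_continuous A (f \o c).

Lemma continuous_along_cst c k : continuous_along c (fun=> k).
Proof. by move=> A _ _; exact: curve_continuous_cst. Qed.

Lemma continuous_along_id c : continuous_along c id.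
Proof. by move=> A. Qed.

Lemma continuous_alongD c f g : continuous_along c f -> continuous_along c g ->
  continuous_along c (fun z => f z + g z).
Proof.
by move=> cf cg A A01 cc; exact: curve_continuousD (cf A A01 cc) (cg A A01 cc).
Qed.

Lemma continuous_alongM c f g : continuous_along c f -> continuous_along c g ->
  continuous_along c (fun z => f z * g z).
Proof.
by move=> cf cg A A01 cc; exact: curve_continuousM (cf A A01 cc) (cg A A01 cc).
Qed.

Lemma continuous_alongX c f n : continuous_along c f ->
  continuous_along c (fun z => f z ^+ n).
Proof.
move=> cf; elim: n => [|n IH].
  rewrite (_ : (fun _ => _) = fun=> 1); last by apply/funext.
  exact: continuous_along_cst.
rewrite (_ : (fun _ => _) = fun z => f z * f z ^+ n); last first.
  by apply/funext => v; rewrite exprS.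
exact: continuous_alongM.
Qed.

Lemma continuous_alongV c f : continuous_along c f ->
  (forall u, u \in `[0, 1] -> f (c u) != 0) ->
  continuous_along c (fun z => (f z)^-1).
Proof.
move=> cf fN0 A A01 cc; apply: curve_continuousV; first exact: cf.
by move=> u /A01; exact: fN0.
Qed.

Lemma continuous_along_subr c k : continuous_along c (fun z => z - k).
Proof.
apply: continuous_alongD; first exact: continuous_along_id.
exact: continuous_along_cst.
Qed.

Lemma continuous_along_cexp c f : continuous_along c f ->
  continuous_along c (fun z => cexp (f z)).
Proof. by move=> cf A A01 cc; exact: (curve_continuous_cexp (cf A A01 cc)). Qed.

Definition smooth_piece c x y :=
  curve_continuous `[x, y] c /\
  exists2 g, curve_continuous `[x, y] g
    & forall u, u \in `]x, y[ -> curve_deriv c u (g u).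

Lemma C1_on_piece c x y : C1_on (fun u => Re (c u)) x y ->
  C1_on (fun u => Im (c u)) x y -> smooth_piece c x y.
Proof.
move=> [dr [gr cgr er]] [di [gi cgi ei]]; split.
  by split; exact: derivable_oo_LRcontinuous_within.
exists (fun u => Complex (gr u) (gi u)); first by split.
move=> u uxy; split.
  by apply: DeriveDef; [case: dr => + _ _; apply|rewrite -derive1E er].
by apply: DeriveDef; [case: di => + _ _; apply|rewrite -derive1E ei].
Qed.

Lemma speed_curve_deriv c u z : curve_deriv c u z -> speed c u = z.
Proof.
move=> [d1 d2]; apply: complex_ext => /=; rewrite derive1E;
  [rewrite (_ : (fun v => _) = Re \o c)//
  |rewrite (_ : (fun v => _) = Im \o c)//]; by rewrite derive_val.
Qed.

Lemma piecewise_C1_elim c (Q : R -> R -> Prop) : piecewise_C1 c ->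
    (forall x, Q x x) ->
    (forall x y z : R, 0 <= x -> x < y -> y <= z -> z <= 1 ->
       smooth_piece c x y -> Q y z -> Q x z) ->
  Q 0 1.
Proof.
move=> [s s01 ps] Q0 Qstep.
have := @itv_partition_elim R (smooth_piece c)
  (fun x y => 0 <= x -> y <= 1 -> Q x y) _ _ s 0 1 s01.
apply => //.
- move=> x y z xy yz pxy Qyz x0 z1; apply: (Qstep x y z) => //.
  by apply: Qyz => //; rewrite (le_trans x0)// ltW.
- by move=> k /ps [p1 p2]; exact: C1_on_piece.
Qed.

Definition contour_integrable c f :=
  mu.-integrable `[0, 1] (EFin \o (fun u => Re (f (c u) * speed c u))) /\
  mu.-integrable `[0, 1] (EFin \o (fun u => Im (f (c u) * speed c u))).

Lemma subitv01 x y : 0 <= x -> y <= 1 -> `[x, y]%classic `<=` `[0, 1]%classic.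
Proof.
move=> x0 y1 u /=; rewrite !in_itv/= => /andP[xu uy].
by rewrite (le_trans x0 xu) (le_trans uy y1).
Qed.

Lemma integrable_point x (h : R -> R) : mu.-integrable `[x, x] (EFin \o h).
Proof.
rewrite set_itv1; apply/integrableP; split; first exact: measurable_fun_set1.
by rewrite integral_set1.
Qed.

Lemma contour_integrable_continuous c f : piecewise_C1 c ->
  continuous_along c f -> contour_integrable c f.
Proof.
move=> pc cf.
pose Q x y :=
  mu.-integrable `[x, y] (EFin \o (fun u => Re (f (c u) * speed c u))) /\
  mu.-integrable `[x, y] (EFin \o (fun u => Im (f (c u) * speed c u))).
apply: (piecewise_C1_elim (Q := Q) pc).
  by move=> x; split; exact: integrable_point.
move=> x y z x0 xy yz z1 [cc [g cg dg]] [Q1 Q2].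
have cfg := curve_continuousM (cf _ (subitv01 x0 (le_trans yz z1)) cc) cg.
split.
- apply: (integrable_cat (ltW xy) yz _ Q1).
  apply: (integrable_eq_interior xy cfg.1) => u /dg /speed_curve_deriv /= ->.
  by [].
- apply: (integrable_cat (ltW xy) yz _ Q2).
  apply: (integrable_eq_interior xy cfg.2) => u /dg /speed_curve_deriv /= ->.
  by [].
Qed.

(** The contour integral of an exact derivative telescopes over the smooth
    pieces of the curve; it vanishes on closed curves. *)
Lemma contour_FTC c f F : piecewise_C1 c ->
    continuous_along c F -> continuous_along c f ->
    (forall u, u \in `[0, 1] -> complex_deriv_at F (c u) (f (c u))) ->
  contour_int c f = F (c 1) - F (c 0).
Proof.
move=> pc cF cf dF.
pose I x y (P : C -> R) :=
  mu.-integrable `[x, y] (EFin \o (fun u => P (f (c u) * speed c u))) /\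
  \int[mu]_(u in `[x, y]) P (f (c u) * speed c u) = P (F (c y)) - P (F (c x)).
suff [[_ hr] [_ hi]] : I 0 1 Re /\ I 0 1 Im.
  apply: complex_ext; rewrite /contour_int/= ?hr ?hi.
    by case: (F _) => ? ?; case: (F _).
  by case: (F _) => ? ?; case: (F _).
apply: (piecewise_C1_elim (Q := fun x y => I x y Re /\ I x y Im) pc).
  move=> x; split; split; try exact: integrable_point.
    by rewrite set_itv1 Rintegral_set1 subrr.
  by rewrite set_itv1 Rintegral_set1 subrr.
move=> x y z x0 xy yz z1 [cc [g cg dg]] [[Q1 Q1'] [Q2 Q2']].
have sxy := subitv01 x0 (le_trans yz z1).
have cfg := curve_continuousM (cf _ sxy cc) cg.
have cFc := cF _ sxy cc.
have eqs u : u \in `]x, y[ -> speed c u = g u by move=> /dg /speed_curve_deriv.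
have dFc u : u \in `]x, y[ -> curve_deriv (F \o c) u (f (c u) * speed c u).
  move=> uxy; rewrite eqs//; apply: dF (dg u uxy) => //.
  by apply: sxy; exact: subitv_oo_cc.
have i1 : mu.-integrable `[x, y] (EFin \o (fun u => Re (f (c u) * speed c u))).
  by apply: (integrable_eq_interior xy cfg.1) => u /eqs /= ->.
have i2 : mu.-integrable `[x, y] (EFin \o (fun u => Im (f (c u) * speed c u))).
  by apply: (integrable_eq_interior xy cfg.2) => u /eqs /= ->.
split; split.
- exact: (integrable_cat (ltW xy) yz i1 Q1).
- rewrite (Rintegral_cat (ltW xy) yz i1 Q1) Q1'.
  suff -> : \int[mu]_(u in `[x, y]) Re (f (c u) * speed c u)
      = Re (F (c y)) - Re (F (c x)) by rewrite /= addrC addrA subrK.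
  by apply: (Rintegral_FTC xy cfg.1 _ cFc.1) => [u /eqs /= ->|u /dFc []].
- exact: (integrable_cat (ltW xy) yz i2 Q2).
- rewrite (Rintegral_cat (ltW xy) yz i2 Q2) Q2'.
  suff -> : \int[mu]_(u in `[x, y]) Im (f (c u) * speed c u)
      = Im (F (c y)) - Im (F (c x)) by rewrite /= addrC addrA subrK.
  by apply: (Rintegral_FTC xy cfg.2 _ cFc.2) => [u /eqs /= ->|u /dFc []].
Qed.

Lemma contour_integrableD c f g : contour_integrable c f ->
  contour_integrable c g ->
  contour_integrable c (fun z => f z + g z).
Proof.
move=> [f1 f2] [g1 g2]; split.
- apply: eq_integrable (integrableD _ f1 g1) => // u _.
  by rewrite /= mulrDl complex_ReD EFinD.
- apply: eq_integrable (integrableD _ f2 g2) => // u _.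
  by rewrite /= mulrDl complex_ImD EFinD.
Qed.

Lemma contour_intD c f g : contour_integrable c f -> contour_integrable c g ->
  contour_int c (fun z => f z + g z) = contour_int c f + contour_int c g.
Proof.
move=> [f1 f2] [g1 g2]; apply: complex_ext.
- rewrite complex_ReD /= -RintegralD//.
  by apply: eq_Rintegral => u _; rewrite mulrDl complex_ReD.
- rewrite complex_ImD /= -RintegralD//.
  by apply: eq_Rintegral => u _; rewrite mulrDl complex_ImD.
Qed.

Lemma integrableZ_EFin (A : set R) (a : R) (h : R -> R) : measurable A ->
  mu.-integrable A (EFin \o h) -> mu.-integrable A (EFin \o (fun u => a * h u)).
Proof. by move=> mA ih; exact: (integrableZl _ a ih). Qed.

Lemma contour_integrableZ c k f : contour_integrable c f ->
  contour_integrable c (fun z => k * f z).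
Proof.
move=> [f1 f2]; split.
- apply: eq_integrable (integrableB _ (integrableZ_EFin (Re k) _ f1)
    (integrableZ_EFin (Im k) _ f2)) => // u _.
  by rewrite /= -mulrA [in RHS]complex_ReM EFinB.
- apply: eq_integrable (integrableD _ (integrableZ_EFin (Re k) _ f2)
    (integrableZ_EFin (Im k) _ f1)) => // u _.
  by rewrite /= -mulrA [in RHS]complex_ImM EFinD.
Qed.

Lemma contour_intZ c k f : contour_integrable c f ->
  contour_int c (fun z => k * f z) = k * contour_int c f.
Proof.
move=> [f1 f2].
apply: complex_ext.
- rewrite complex_ReM /= -!RintegralZl// -RintegralB//;
    [|exact: integrableZ_EFin..].
  by apply: eq_Rintegral => u _; rewrite -mulrA complex_ReM.
- rewrite complex_ImM /= -!RintegralZl// -RintegralD//;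
    [|exact: integrableZ_EFin..].
  by apply: eq_Rintegral => u _; rewrite -mulrA complex_ImM.
Qed.

Lemma eq_contour_int c f g : (forall u, u \in `[0, 1] -> f (c u) = g (c u)) ->
  contour_int c f = contour_int c g.
Proof.
move=> fg; apply: complex_ext => /=; apply: eq_Rintegral => u;
  by rewrite inE/= => /fg ->.
Qed.

Lemma eq_contour_integrable c f g :
    (forall u, u \in `[0, 1] -> f (c u) = g (c u)) ->
  contour_integrable c f -> contour_integrable c g.
Proof.
move=> fg [f1 f2]; split.
- by apply: eq_integrable f1 => // u; rewrite inE/= => /fg ->.
- by apply: eq_integrable f2 => // u; rewrite inE/= => /fg ->.
Qed.

End ContourIntegrals.

(** * The exponential with a simple pole *)

Section ExponentialKernel.
Local Open Scope classical_set_scope.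
Local Open Scope ring_scope.
Variable R : realType.
Local Notation mu := (@lebesgue_measure R).
Local Notation C := R[i].
Local Notation Re := (@complex.Re R).
Local Notation Im := (@complex.Im R).
Implicit Types (z w k p : C) (c : R -> C) (f g F : C -> C).
Implicit Types (t u x y : R) (A : set R).

Lemma cexp0 : cexp 0 = 1 :> C.
Proof. by rewrite /cexp /= expR0 cos0 sin0 mulr1 mulr0. Qed.

Lemma cexpD z w : cexp (z + w) = cexp z * cexp w.
Proof.
apply: complex_ext;
  rewrite ?complex_ReM ?complex_ImM /= complex_ReD complex_ImD expRD.
  by rewrite cosD; ring.
by rewrite sinD; ring.
Qed.

Lemma complex_deriv_expN t p z :
  complex_deriv_at (fun z => cexp (- (t%:C%C * (z - p)))) z
    (- t%:C%C * cexp (- (t%:C%C * (z - p)))).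
Proof.
pose F z := - t%:C%C * (z - p).
rewrite (_ : (fun z => _) = fun z => cexp (F z)); last first.
  by apply/funext => v; rewrite /F mulNr.
rewrite -!mulNr; apply: complex_deriv_cexp.
have := complex_derivM (@complex_deriv_cst _ (- t%:C%C) z)
   (complex_derivD (@complex_deriv_id _ z) (@complex_deriv_cst _ (- p) z)).
by move/complex_deriv_eq; apply; rewrite mul0r add0r addr0 mulr1.
Qed.

Lemma continuous_along_expN c t p :
  continuous_along c (fun z => cexp (- (t%:C%C * (z - p)))).
Proof.
apply: continuous_along_cexp.
rewrite (_ : (fun z => _) = fun z => - t%:C%C * (z + - p)); last first.
  by apply/funext => v; rewrite mulNr.
apply: continuous_alongM; first exact: continuous_along_cst.
exact: continuous_along_subr.
Qed.

(** A primitive is [exp(- t (z - p)) / t] for [t != 0], and [- z] for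
    [t = 0]. *)
Lemma closed_expN_int0 c t p : piecewise_C1 c -> c 0 = c 1 ->
  contour_int c (fun z => - cexp (- (t%:C%C * (z - p)))) = 0.
Proof.
move=> pc c01.
have exact0 F f : continuous_along c F -> continuous_along c f ->
    (forall z, complex_deriv_at F z (f z)) -> contour_int c f = 0.
  move=> cF cf dF; rewrite (contour_FTC pc cF cf (fun u _ => dF (c u))).
  by rewrite c01 subrr.
have cstM F k : continuous_along c F -> continuous_along c (fun z => k * F z).
  by apply: continuous_alongM; exact: continuous_along_cst.
rewrite (_ : (fun z => _) =
    fun z => -1 * cexp (- (t%:C%C * (z - p)))); last first.
  by apply/funext => v; rewrite mulN1r.
have [t0|t0] := eqVneq t 0.
  apply: (exact0 (fun z => -1 * z)).
  - by apply: cstM; exact: continuous_along_id.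
  - by apply: cstM; exact: continuous_along_expN.
  - move=> z; rewrite t0 mul0r oppr0 cexp0.
    have := complex_derivM (@complex_deriv_cst _ (-1) z) (@complex_deriv_id _ z).
    by rewrite mul0r add0r.
have tC0 : t%:C%C != 0 :> C by rewrite eq_complex /= negb_and t0.
apply: (exact0 (fun z => (t%:C%C)^-1 * cexp (- (t%:C%C * (z - p))))).
- by apply: cstM; exact: continuous_along_expN.
- by apply: cstM; exact: continuous_along_expN.
- move=> z; have := complex_derivM (@complex_deriv_cst _ (t%:C%C)^-1 z)
    (@complex_deriv_expN t p z).
  by rewrite mul0r add0r mulrA mulrN mulVf.
Qed.

Lemma curve_deriv_real t : curve_deriv (fun t => t%:C%C) t (1 : C).
Proof.
split => /=.
  rewrite (_ : _ \o _ = id); last exact/funext.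
  exact: is_derive_id.
rewrite (_ : _ \o _ = cst 0); last exact/funext.
exact: is_derive_cst.
Qed.

Lemma curve_deriv_kernel t w k : w != 0 ->
  curve_deriv (fun t => cexp (- (t%:C%C * w)) / w * k) t
    (- cexp (- (t%:C%C * w)) * k).
Proof.
move=> w0.
pose F z := (w^-1 * k) * cexp (- w * z).
have hF z : complex_deriv_at F z (- cexp (- w * z) * k).
  have := complex_derivM (@complex_deriv_cst _ (w^-1 * k) z) (complex_deriv_cexp
    (complex_derivM (@complex_deriv_cst _ (- w) z) (@complex_deriv_id _ z))).
  by move/complex_deriv_eq; apply; field.
have := hF _ _ _ _ erefl (curve_deriv_real t); rewrite mulr1.
have e s : - w * s%:C%C = - (s%:C%C * w) by rewrite mulNr mulrC.
rewrite e; congr curve_deriv; apply/funext => s.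
by rewrite /F /= e mulrC mulrA.
Qed.

(** For [|t| <= M] the modulus of [exp(- t (z - p))] is at most
    [exp (M |Re (z - p)|)], a continuous function of [z]; it dominates the
    derivative in [t] uniformly for [t] in a bounded interval. *)
Definition expbound (M : R) p z : C := (expR (M * `|Re (z - p)|))%:C%C.

Lemma continuous_along_expbound c M p : continuous_along c (expbound M p).
Proof.
move=> A A01 cc.
have /curve_continuousP cp : curve_continuous A (fun u => c u - p).
  by apply: curve_continuousD => //; exact: curve_continuous_cst.
apply/curve_continuousP => u Au; have [c1 _] := cp u Au.
split => /=; last exact: cvg_cst.
apply: (continuous_cvg _ (@continuous_expR _ _)).
by apply: cvgM; [exact: cvg_cst|exact: cvg_norm].
Qed.

(** The real and imaginary parts of [r (cos th + i sin th) k] are of the form on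
    the left, with [s1] and [s2] the parts of [k]. *)
Lemma norm_rotation_le (r e a b s1 s2 : R) : 0 <= r -> r <= e ->
  `|a| <= 1 -> `|b| <= 1 -> `|r * a * s1 + r * b * s2| <= `|e * s1| + `|e * s2|.
Proof.
move=> r0 re a1 b1; have e0 := le_trans r0 re.
apply: (le_trans (ler_normD _ _)).
rewrite !normrM (ger0_norm r0) (ger0_norm e0).
apply: lerD; apply: ler_wpM2r => //.
  by rewrite -[leRHS]mulr1; apply: ler_pM.
by rewrite -[leRHS]mulr1; apply: ler_pM.
Qed.

Lemma norm_cexp_kernel_le M t p z k : `|t| <= M ->
  let B := `|Re (expbound M p z * k)| + `|Im (expbound M p z * k)| in
  `|Re (- cexp (- (t%:C%C * (z - p))) * k)| <= B /\
  `|Im (- cexp (- (t%:C%C * (z - p))) * k)| <= B.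
Proof.
move=> tM B; rewrite {}/B.
set v := z - p.
have -> : Re (expbound M p z * k) = expR (M * `|Re v|) * Re k.
  by rewrite complex_ReM /= mul0r subr0.
have -> : Im (expbound M p z * k) = expR (M * `|Re v|) * Im k.
  by rewrite complex_ImM /= mul0r addr0.
set r := expR (- (t * Re v)); set th := - (t * Im v).
have -> : cexp (- (t%:C%C * v)) = Complex (r * cos th) (r * sin th).
  by rewrite /cexp /r /th; case: (v) => a b /=; rewrite !mul0r subr0 addr0.
have r0 : 0 <= r by exact: expR_ge0.
have re : r <= expR (M * `|Re v|).
  rewrite ler_expR; apply: le_trans (ler_norm _) _.
  by rewrite normrN normrM ler_wpM2r.
have c1 : `|cos th| <= 1 by rewrite ler_norml cos_geN1 cos_le1.
have s1 : `|sin th| <= 1 by rewrite ler_norml sin_geN1 sin_le1.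
rewrite complex_ReM complex_ImM /=; split.
- have := @norm_rotation_le r _ (- cos th) (sin th) (Re k) (Im k) r0 re.
  rewrite normrN => /(_ c1 s1); congr (`| _ | <= _); ring.
- have := @norm_rotation_le r _ (- sin th) (- cos th) (Re k) (Im k) r0 re.
  rewrite !normrN => /(_ s1 c1); congr (`| _ | <= _); ring.
Qed.

(** Differentiating in [t] under the integral sign cancels the pole: the
    derivative is the integral of [- exp(- t (z - p))], which is zero on a closed
    curve by [closed_expN_int0].  The integral is therefore constant in [t]. *)
Lemma expN_kernel_int c t p : piecewise_C1 c -> c 0 = c 1 -> avoids c p ->
  contour_int c (fun z => cexp (- (t%:C%C * (z - p))) / (z - p))
    = contour_int c (fun z => (z - p)^-1).
Proof.
move=> pc c01 cp.
have cpN0 u : u \in `[0, 1] -> c u - p != 0 by move=> /cp; rewrite subr_eq0.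
pose K t z := cexp (- (t%:C%C * (z - p))) / (z - p).
have iK s : contour_integrable c (K s).
  apply: contour_integrable_continuous => //.
  apply: continuous_alongM; first exact: continuous_along_expN.
  by apply: continuous_alongV => //; exact: continuous_along_subr.
have dK s u : u \in `[0, 1] ->
    curve_deriv (fun s => K s (c u) * speed c u) s
      (- cexp (- (s%:C%C * (c u - p))) * speed c u).
  by move=> u01; exact: (curve_deriv_kernel s (speed c u) (cpN0 u u01)).
(* Differentiation under the integral is done for the real and the imaginary
   part; P stands for either projection. *)
have J (P : C -> R) :
    (forall s, mu.-integrable `[0, 1]
       (EFin \o (fun u => P (K s (c u) * speed c u)))) ->
    (forall s u : R, u \in `[0, 1] ->
      is_derive s (1 : R) (fun s => P (K s (c u) * speed c u))
        (P (- cexp (- (s%:C%C * (c u - p))) * speed c u))) ->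
    (forall M s z k, `|s| <= M -> `|P (- cexp (- (s%:C%C * (z - p))) * k)|
       <= `|Re (expbound M p z * k)| + `|Im (expbound M p z * k)|) ->
    (forall s, \int[mu]_(u in `[0, 1])
        P (- cexp (- (s%:C%C * (c u - p))) * speed c u) = 0) ->
    \int[mu]_(u in `[0, 1]) P (K t (c u) * speed c u)
      = \int[mu]_(u in `[0, 1]) P (K 0 (c u) * speed c u).
  move=> iP dP bP zP.
  pose f s u := P (K s (c u) * speed c u).
  apply: (@is_derive_0_is_cst R (fun s => \int[mu]_(u in `[0, 1]) f s u)) => s.
  pose M := `|s| + 1.
  pose G u := `|Re (expbound M p (c u) * speed c u)|
              + `|Im (expbound M p (c u) * speed c u)|.
  have G0 u : 0 <= G u by rewrite addr_ge0.
  have [b1 b2] := contour_integrable_continuous pc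
    (@continuous_along_expbound c M p).
  have iG : mu.-integrable `[0, 1] (EFin \o G).
    by apply: eq_integrable (integrableD _ (integrable_abse b1)
      (integrable_abse b2)).
  have ss : `]s - 1, s + 1[%classic s.
    by rewrite /= in_itv/=; apply/andP; split; lra.
  have d1 s' u : u \in `[0, 1] -> partial1of2 f s' u
      = P (- cexp (- (s'%:C%C * (c u - p))) * speed c u).
    move=> u01; rewrite partial1of2E.
    by have h := dP s' u u01; exact: derive_val.
  have bG s' u : `]s - 1, s + 1[%classic s' -> `[0, 1]%classic u ->
      `|partial1of2 f s' u| <= G u.
    rewrite /= in_itv/= => /andP[s1 s2] u01; rewrite d1//; apply: bP.
    by rewrite ler_norml /M; have := ler_norm s; have := ler_norm (- s);
       rewrite normrN => *; apply/andP; split; lra.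
  have df s' u : `]s - 1, s + 1[%classic s' -> `[0, 1]%classic u ->
      derivable (f ^~ u) s' 1.
    by move=> _ /(dP s') ?; exact: ex_derive.
  have m01 : measurable (`[0, 1]%classic : set (measurableTypeR R)) by [].
  apply: DeriveDef.
    exact: (derivable_under_integral m01 ss (fun s' _ => iP s') df G0 iG bG).
  rewrite -derive1E.
  rewrite (differentiation_under_integral m01 ss (fun s' _ => iP s')
    df G0 iG bG).
  rewrite -[RHS](zP s); apply: eq_Rintegral => u; rewrite inE /= => u01.
  exact: d1.
rewrite -[RHS](@eq_contour_int _ c (K 0)); last first.
  by move=> u _; rewrite /K mul0r oppr0 cexp0 mul1r.
apply: complex_ext; apply: J.
- by move=> s; exact: (iK s).1.
- by move=> s u u01; exact: (dK s u u01).1.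
- by move=> M s z k h; exact: (norm_cexp_kernel_le p z k h).1.
- by move=> s; have /(congr1 Re) := closed_expN_int0 s p pc c01.
- by move=> s; exact: (iK s).2.
- by move=> s u u01; exact: (dK s u u01).2.
- by move=> M s z k h; exact: (norm_cexp_kernel_le p z k h).2.
- by move=> s; have /(congr1 Im) := closed_expN_int0 s p pc c01.
Qed.

End ExponentialKernel.

(** * Partial fractions *)

Section PartialFractions.
Variable C : fieldType.
Variable pole : C -> Prop.
Implicit Types (p q k z : C) (f g : C -> C).

(** The span of the powers and of the simple fractions with a pole in [pole],
    as functions off the poles. *)
Inductive pfrac : (C -> C) -> Prop :=
| PfracX n : pfrac (fun z => z ^+ n)
| PfracV p n : pole p -> pfrac (fun z => (z - p)^-1 ^+ n.+1)
| PfracD f g : pfrac f -> pfrac g -> pfrac (fun z => f z + g z)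
| PfracZ k f : pfrac f -> pfrac (fun z => k * f z)
| PfracE f g : (forall z, (forall p, pole p -> z != p) -> f z = g z) ->
    pfrac f -> pfrac g.

(** Dividing a generator by [z - p] stays in the span because of
    [z ^ (n + 1) / (z - p) = z ^ n + p z ^ n / (z - p)] and, for [p != q],
    [(z - p)^-1 (z - q)^-1 = (p - q)^-1 ((z - p)^-1 - (z - q)^-1)]. *)
Lemma pfrac_divr f p : pole p -> pfrac f -> pfrac (fun z => f z / (z - p)).
Proof.
move=> pp pf; elim: pf p pp => {f}
  [n|q n pq|f g _ IHf _ IHg|k f _ IHf|f g fg _ IHf] p pp.
- elim: n => [|n IH].
    by apply: PfracE (PfracV 0 pp) => z _; rewrite expr1 expr0 mul1r.
  apply: PfracE (PfracD (PfracX n) (PfracZ p IH)) => z /(_ p pp).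
  by rewrite -subr_eq0 => zp; rewrite exprS; field.
- have [<-|qp] := eqVneq q p.
    by apply: PfracE (PfracV n.+1 pq) => z _; rewrite [in LHS]exprSr.
  have dpq : p - q != 0 by rewrite subr_eq0 eq_sym.
  elim: n => [|n IH].
    apply: PfracE (PfracZ (p - q)^-1 (PfracD (PfracV 0 pp)
      (PfracZ (-1) (PfracV 0 pq)))) => z h.
    have zp : z - p != 0 by rewrite subr_eq0 h.
    have zq : z - q != 0 by rewrite subr_eq0 h.
    by rewrite !expr1; field; rewrite zq zp dpq.
  apply: PfracE (PfracZ (p - q)^-1 (PfracD IH
    (PfracZ (-1) (PfracV n.+1 pq)))) => z h.
  have zp : z - p != 0 by rewrite subr_eq0 h.
  have zq : z - q != 0 by rewrite subr_eq0 h.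
  rewrite [in RHS]exprSr [in LHS](exprSr _ n.+1).
  by move: ((z - q)^-1 ^+ n.+1) => y; field; rewrite zq zp dpq.
- by apply: PfracE (PfracD (IHf p pp) (IHg p pp)) => z _; rewrite mulrDl.
- by apply: PfracE (PfracZ k (IHf p pp)) => z _; rewrite mulrA.
- by apply: PfracE (IHf p pp) => z h; rewrite fg.
Qed.

Lemma pfrac_poly (Q : {poly C}) : pfrac (horner Q).
Proof.
elim/poly_ind: Q => [|Q k _].
  by apply: PfracE (PfracZ 0 (PfracX 0)) => z _; rewrite mul0r horner0.
have sumX (m : nat) (e : nat -> C) : pfrac (fun z => \sum_(i < m) e i * z ^+ i).
  elim: m => [|m IH].
    by apply: PfracE (PfracZ 0 (PfracX 0)) => z _; rewrite big_ord0 mul0r.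
  apply: PfracE (PfracD IH (PfracZ (e m) (PfracX m))) => z _.
  by rewrite big_ord_recr.
move: (Q * 'X + k%:P) => P.
by apply: PfracE (sumX (size P) (fun i => P`_i)) => z _; rewrite horner_coef.
Qed.

Lemma pfrac_rational (Q : {poly C}) (ps : seq C) :
    (forall p, p \in ps -> pole p) ->
  pfrac (fun z => Q.[z] * \prod_(p <- ps) (z - p)^-1).
Proof.
elim: ps => [|p ps IH] h.
  by apply: PfracE (pfrac_poly Q) => z _; rewrite big_nil mulr1.
have pp : pole p by apply: h; rewrite mem_head.
apply: PfracE (pfrac_divr pp (IH _)) => [z _|q qps].
  by rewrite big_cons mulrCA mulrA mulrC mulrA mulrC.
by apply: h; rewrite inE qps orbT.
Qed.

End PartialFractions.

(** * Dependence of contour integrals on winding numbers *)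

Lemma two_pi_i_neq0 (R : realType) : two_pi_i R != 0.
Proof.
rewrite eq_complex /= negb_and; apply/orP; right.
by apply: mulf_neq0; [rewrite pnatr_eq0|rewrite gt_eqF// pi_gt0].
Qed.

Section LoopIndependence.
Local Open Scope classical_set_scope.
Local Open Scope ring_scope.
Variable R : realType.
Local Notation C := R[i].
Variables c c' : R -> C.
Hypotheses (pc : piecewise_C1 c) (pc' : piecewise_C1 c').
Hypotheses (c01 : c 0 = c 1) (c01' : c' 0 = c' 1).
Implicit Types (z k p : C) (f g F : C -> C).

Definition same_contour_int f :=
  [/\ contour_integrable c f, contour_integrable c' f
    & contour_int c f = contour_int c' f].

Lemma same_contour_intD f g : same_contour_int f -> same_contour_int g ->
  same_contour_int (fun z => f z + g z).
Proof.
move=> [f1 f2 f3] [g1 g2 g3]; split; [exact: contour_integrableD..|].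
by rewrite (contour_intD f1 g1) (contour_intD f2 g2) f3 g3.
Qed.

Lemma same_contour_intZ k f : same_contour_int f ->
  same_contour_int (fun z => k * f z).
Proof.
move=> [f1 f2 f3]; split; [exact: contour_integrableZ..|].
by rewrite (contour_intZ k f1) (contour_intZ k f2) f3.
Qed.

Lemma same_contour_int_eq f g :
  (forall u, u \in `[0, 1] -> f (c u) = g (c u) /\ f (c' u) = g (c' u)) ->
  same_contour_int f -> same_contour_int g.
Proof.
move=> fg [f1 f2 f3]; split.
- by apply: eq_contour_integrable f1 => u /fg [].
- by apply: eq_contour_integrable f2 => u /fg [].
- have <- : contour_int c f = contour_int c g.
    by apply: eq_contour_int => u /fg [].
  by rewrite f3; apply: eq_contour_int => u /fg [].
Qed.

(** Both integrals vanish, since both curves are closed. *)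
Lemma same_contour_int_exact f F :
    (forall d, d = c \/ d = c' ->
       continuous_along d F /\ continuous_along d f) ->
    (forall u, u \in `[0, 1] -> complex_deriv_at F (c u) (f (c u)) /\
       complex_deriv_at F (c' u) (f (c' u))) ->
  same_contour_int f.
Proof.
move=> cf dF; have [cF1 cf1] := cf c (or_introl erefl).
have [cF2 cf2] := cf c' (or_intror erefl).
split; [exact: contour_integrable_continuous..|].
rewrite (contour_FTC pc cF1 cf1 (fun u h => (dF u h).1)).
by rewrite (contour_FTC pc' cF2 cf2 (fun u h => (dF u h).2)) c01 c01' !subrr.
Qed.

Definition same_winding p :=
  [/\ avoids c p, avoids c' p & winding_number c p = winding_number c' p].

Variable tau : R.
Let E z := cexp (- (tau%:C%C * z)).

Lemma continuous_along_E d : continuous_along d E.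
Proof.
rewrite (_ : E = fun z => cexp (- (tau%:C%C * (z - 0)))).
  exact: continuous_along_expN.
by apply/funext => z; rewrite subr0.
Qed.

Lemma complex_deriv_E z : complex_deriv_at E z (- tau%:C%C * E z).
Proof.
have := @complex_deriv_expN R tau 0 z; rewrite subr0.
by rewrite (_ : (fun z => _) = E)//; apply/funext => v; rewrite subr0.
Qed.

(** For [tau != 0], the derivative of [exp(- tau z) z ^ n] has integral zero
    and expresses [exp(- tau z) z ^ n] by the preceding power; for [tau = 0] the
    function has the primitive [z ^ (n + 1) / (n + 1)]. *)
Lemma same_contour_int_expX n : same_contour_int (fun z => E z * z ^+ n).
Proof.
have contX d m : continuous_along d (fun z : C => z ^+ m).
  by apply: continuous_alongX; exact: continuous_along_id.
have cEX d m : continuous_along d (fun z => E z * z ^+ m).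
  by apply: continuous_alongM; [exact: continuous_along_E|].
have [t0|t0] := eqVneq tau 0.
  have E1 z : E z = 1 by rewrite /E t0 mul0r oppr0 cexp0.
  apply: (@same_contour_int_eq (fun z => n.+1%:R^-1 * (n.+1%:R * z ^+ n))).
    by move=> u _; rewrite !E1 !mul1r !mulKf// pnatr_eq0.
  apply: same_contour_intZ.
  apply: (@same_contour_int_exact _ (fun z => z ^+ n.+1)) => [d _|u _].
    split=> //; apply: continuous_alongM; last exact: contX.
    exact: continuous_along_cst.
  have dX z : complex_deriv_at (fun z => z ^+ n.+1) z (n.+1%:R * z ^+ n).
    by move: (complex_derivX n.+1 (@complex_deriv_id _ z)); rewrite mulr1.
  by split; exact: dX.
have tC0 : tau%:C%C != 0 :> C by rewrite eq_complex /= negb_and t0.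
have ex m : same_contour_int
    (fun z => - tau%:C%C * E z * z ^+ m + E z * (m%:R * z ^+ m.-1)).
  apply: (@same_contour_int_exact _ (fun z => E z * z ^+ m)) => [d _|u _].
    split=> //; apply: continuous_alongD; apply: continuous_alongM => //.
    - by apply: continuous_alongM;
        [exact: continuous_along_cst|exact: continuous_along_E].
    - exact: continuous_along_E.
    - by apply: continuous_alongM; [exact: continuous_along_cst|].
  have dX z : complex_deriv_at (fun z => E z * z ^+ m) z
      (- tau%:C%C * E z * z ^+ m + E z * (m%:R * z ^+ m.-1)).
    have := complex_derivM (@complex_deriv_E z)
      (complex_derivX m (@complex_deriv_id _ z)).
    by rewrite mulr1.
  by split; exact: dX.
elim: n => [|n IH].
  apply: same_contour_int_eq
    (same_contour_intZ (- (tau%:C%C)^-1) (ex 0)) => u _.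
  by split; rewrite expr0; field.
apply: same_contour_int_eq (same_contour_intD
  (same_contour_intZ (- (tau%:C%C)^-1) (ex n.+1))
  (same_contour_intZ (n.+1%:R / tau%:C%C) IH)) => u _ /=.
by split; rewrite exprS; field.
Qed.

(** Up to the constant factor [exp(- tau p)], the simple pole is
    [expN_kernel_int].  A pole of order [n + 2] is reduced to one of order
    [n + 1] by the derivative of [exp(- tau z) / (z - p) ^ (n + 1)], whose
    integral is zero. *)
Lemma same_contour_int_expV p n : same_winding p ->
  same_contour_int (fun z => E z * (z - p)^-1 ^+ n.+1).
Proof.
move=> [ap ap' wp].
have n0 u : u \in `[0, 1] -> c u - p != 0 by move=> /ap; rewrite subr_eq0.
have n0' u : u \in `[0, 1] -> c' u - p != 0 by move=> /ap'; rewrite subr_eq0.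
have contV d m : d = c \/ d = c' ->
    continuous_along d (fun z : C => (z - p)^-1 ^+ m).
  move=> [->|->]; apply: continuous_alongX; apply: continuous_alongV.
  - exact: continuous_along_subr.
  - exact: n0.
  - exact: continuous_along_subr.
  - exact: n0'.
have cEV d m : d = c \/ d = c' ->
    continuous_along d (fun z => E z * (z - p)^-1 ^+ m).
  by move=> dcc; apply: continuous_alongM;
    [exact: continuous_along_E|exact: contV].
elim: n => [|n IH].
  pose f z := cexp (- (tau%:C%C * (z - p))) / (z - p).
  have sf : same_contour_int f.
    have cf d : d = c \/ d = c' -> continuous_along d f.
      move=> dcc; apply: continuous_alongM; first exact: continuous_along_expN.
      exact: (contV d 1%N dcc).
    split.
    - exact: contour_integrable_continuous pc (cf _ (or_introl erefl)).
    - exact: contour_integrable_continuous pc' (cf _ (or_intror erefl)).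
    rewrite (expN_kernel_int tau pc c01 ap) (expN_kernel_int tau pc' c01' ap').
    exact: (mulfI (invr_neq0 (two_pi_i_neq0 R))).
  apply: same_contour_int_eq
    (same_contour_intZ (cexp (- (tau%:C%C * p))) sf) => u _.
  have e z : cexp (- (tau%:C%C * p)) * f z = E z * (z - p)^-1 ^+ 1.
    rewrite expr1 /f mulrA -cexpD /E; congr (cexp _ * _).
    by rewrite mulrBr; ring.
  by split; exact: e.
have dV z : z - p != 0 -> complex_deriv_at (fun z => E z * (z - p)^-1 ^+ n.+1) z
   (- tau%:C%C * (E z * (z - p)^-1 ^+ n.+1)
    + - n.+1%:R * (E z * (z - p)^-1 ^+ n.+2)).
  move=> zp; have := complex_derivM (@complex_deriv_E z) (complex_derivX n.+1
    (@complex_derivV R (fun z => z - p) z _ zp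
      (complex_derivD (@complex_deriv_id _ z)
        (@complex_deriv_cst _ (- p) z)))).
  move/complex_deriv_eq; apply; rewrite /= addr0 !exprS !expr0 mulr1.
  by move: ((z - p)^-1 ^+ n) => y; field.
have ex : same_contour_int (fun z => - tau%:C%C * (E z * (z - p)^-1 ^+ n.+1)
    + - n.+1%:R * (E z * (z - p)^-1 ^+ n.+2)).
  apply: (@same_contour_int_exact _ (fun z => E z * (z - p)^-1 ^+ n.+1))
    => [d dcc|u u01].
    split; first exact: cEV.
    apply: continuous_alongD; apply: continuous_alongM.
    - exact: continuous_along_cst.
    - exact: cEV.
    - exact: continuous_along_cst.
    - exact: cEV.
  by split; apply: dV; [exact: n0|exact: n0'].
have nn0 : n.+1%:R != 0 :> C by rewrite pnatr_eq0.
apply: same_contour_int_eq (same_contour_intZ (- n.+1%:R^-1)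
  (same_contour_intD ex (same_contour_intZ tau%:C%C IH))) => u _ /=.
by split; field.
Qed.

Lemma same_contour_int_pfrac f : pfrac same_winding f ->
  same_contour_int (fun z => E z * f z).
Proof.
elim=> {f} [n|p n pp|f g _ IHf _ IHg|k f _ IHf|f g fg _ IHf].
- exact: same_contour_int_expX.
- exact: same_contour_int_expV.
- apply: same_contour_int_eq (same_contour_intD IHf IHg) => u _.
  by rewrite !mulrDr.
- apply: same_contour_int_eq (same_contour_intZ k IHf) => u _.
  by rewrite ![k * (_ * _)]mulrCA.
- apply: same_contour_int_eq IHf => u u01.
  by split; rewrite fg// => p [ap ap' _]; [exact: ap|exact: ap'].
Qed.

End LoopIndependence.

(** * Sums over permutations and reversal of columns *)

Section DeterminantAlgebra.

Lemma sqr_Vandermonde_expand (F : comNzRingType) r (z : seq F) :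
  \prod_(k < r) \prod_(l < r | (k < l)%N) (z`_k - z`_l) ^+ 2
  = \sum_(st : ('S_r * 'S_r)%type) (-1) ^+ st.1 * (-1) ^+ st.2
      * \prod_(k < r) (z`_k ^+ st.1 k * z`_k ^+ st.2 k).
Proof.
pose V := Vandermonde r (\row_(k < r) z`_k).
have detV : \det V = \sum_(s : 'S_r) (-1) ^+ s * \prod_(k < r) z`_k ^+ s k.
  rewrite -det_tr; apply: eq_bigr => s _; congr (_ * _).
  by apply: eq_bigr => k _; rewrite !mxE.
transitivity (\det V * \det V).
  rewrite -expr2 det_Vandermonde -prodrXl; apply: eq_bigr => k _.
  rewrite -prodrXl; apply: eq_bigr => l _; rewrite !mxE.
  by rewrite -sqrrN opprB.
rewrite detV big_distrlr pair_bigA /=; apply: eq_bigr => -[s t] _ /=.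
by rewrite big_split mulrACA.
Qed.

(** Andreief's identity in discrete form: for fixed [s] the sum over [t] is the
    determinant of [M] with its rows permuted by [s], so that the two signs
    cancel and each of the [r!] permutations [s] contributes [\det M]. *)
Lemma sum_perm_pair (F : comNzRingType) r (M : 'M[F]_r) :
  \sum_(st : ('S_r * 'S_r)%type) (-1) ^+ st.1 * (-1) ^+ st.2
      * \prod_(k < r) M (st.1 k) (st.2 k) = r`!%:R * \det M.
Proof.
rewrite -(pair_bigA _ (fun s t : 'S_r =>
  (-1) ^+ s * (-1) ^+ t * \prod_(k < r) M (s k) (t k))) /=.
transitivity (\sum_(s : 'S_r) \det M).
  apply: eq_bigr => s _; transitivity ((-1) ^+ s * \det (row_perm s M)).
    rewrite /determinant big_distrr /=; apply: eq_bigr => t _.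
    by rewrite mulrA; congr (_ * _); apply: eq_bigr => k _; rewrite mxE.
  by rewrite row_permE det_mulmx det_perm mulrA -signr_addb addbb mul1r.
by rewrite sumr_const card_Sn mulr_natl.
Qed.

Definition rev_perm r : 'S_r := perm (@rev_ord_inj r).

(** In this form the sign of the reversal follows by induction from
    [odd_lift_perm]. *)
Lemma rev_perm_lift r : rev_perm r.+1 = lift_perm ord0 ord_max (rev_perm r).
Proof.
apply/permP => i; rewrite permE; case: (unliftP ord0 i) => [j|] ->.
  rewrite lift_perm_lift permE; apply/val_inj => /=.
  rewrite /bump /= add1n subSS leqNgt ltn_subrL /=.
  by rewrite (leq_ltn_trans (leq0n j) (ltn_ord j)).
by rewrite lift_perm_id; apply/val_inj; rewrite /= subn1.
Qed.

Lemma sign_rev_perm (F : pzRingType) r :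
  (-1) ^+ r * (-1) ^+ rev_perm r = (-1) ^+ (r * r.+1)./2 :> F.
Proof.
elim: r => [|r IH].
  by rewrite (_ : rev_perm 0 = 1%g) ?odd_perm1 ?mulr1//; apply/permP => -[].
have -> : (r.+1 * r.+2)./2 = (r.+1 + (r * r.+1)./2)%N.
  have -> : (r.+1 * r.+2 = r * r.+1 + r.+1.*2)%N by rewrite -muln2; ring.
  by rewrite halfD odd_double andbF add0n doubleK addnC.
by rewrite exprD -IH rev_perm_lift odd_lift_perm signr_addb addFb signr_odd.
Qed.

End DeterminantAlgebra.

(** * Iterated integrals, Hankel and Toeplitz determinants *)

Section Moments.
Local Open Scope classical_set_scope.
Local Open Scope ring_scope.
Variable R : realType.
Local Notation C := R[i].
Implicit Types (c : R -> C) (P Q : {poly C}).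

Lemma contour_int_sum (I : Type) (s : seq I) (k : I -> C) (f : I -> C -> C) c :
    (forall i, contour_integrable c (f i)) ->
  contour_integrable c (fun z => \sum_(i <- s) k i * f i z) /\
  contour_int c (fun z => \sum_(i <- s) k i * f i z)
    = \sum_(i <- s) k i * contour_int c (f i).
Proof.
move=> cf; elim: s => [|i s [IH1 IH2]].
  rewrite big_nil (_ : (fun z => _) = fun z => 0); last first.
    by apply/funext => z; rewrite big_nil.
  have c0 : contour_integrable c (fun=> 0).
    have i0 : lebesgue_measure.-integrable `[0, 1]%classic
        (EFin \o (fun _ : R => 0)).
      exact: integrable0.
    split; rewrite (_ : EFin \o _ = EFin \o (fun=> 0))//; apply/funext => u /=;
      by rewrite !mul0r ?subrr ?addr0.
  by split=> //; have := contour_intZ 0 c0; rewrite !mul0r.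
rewrite big_cons (_ : (fun z => _) =
    fun z => k i * f i z + \sum_(j <- s) k j * f j z); last first.
  by apply/funext => z; rewrite big_cons.
have cki := contour_integrableZ (k i) (cf i).
split; first exact: contour_integrableD.
by rewrite (contour_intD cki IH1) IH2 (contour_intZ (k i) (cf i)).
Qed.

(** With separated variables each inner integral is a constant factor of the
    next one, so that no exchange of integrations is involved and every variable
    may run over its own curve. *)
Lemma iter_contour_int_sum (I : finType) (cs : seq (R -> C)) :
  forall (k : I -> C) (h : I -> nat -> C -> C) (F : seq C -> C),
    (forall zs, size zs = size cs ->
       F zs = \sum_i k i * \prod_(m < size cs) h i m zs`_m) ->
    (forall i m, (m < size cs)%N ->
       contour_integrable (nth (fun=> 0) cs m) (h i m)) ->
  iter_contour_int cs F
    = \sum_i k i * \prod_(m < size cs) contour_int (nth (fun=> 0) cs m) (h i m).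
Proof.
elim: cs => [|c cs IH] k h F hF ih /=.
  by rewrite hF//; apply: eq_bigr => i _; rewrite !big_ord0.
pose D i := \prod_(m < size cs) contour_int (nth (fun=> 0) cs m) (h i m.+1).
rewrite (_ : (fun z => _) =
    fun z => \sum_i (k i * D i) * h i 0%N z); last first.
  apply/funext => z.
  rewrite (IH (fun i => k i * h i 0%N z) (fun i m => h i m.+1)).
  - by apply: eq_bigr => i _; rewrite mulrAC.
  - move=> zs szs; rewrite hF /= ?szs//; apply: eq_bigr => i _.
    by rewrite big_ord_recl /= mulrA.
  - by move=> i m ms; exact: (ih i m.+1).
have ih0 i : contour_integrable c (h i 0%N) by exact: (ih i 0%N).
rewrite (contour_int_sum _ (fun i => k i * D i) ih0).2.
by apply: eq_bigr => i _; rewrite big_ord_recl /= -mulrA [D i * _]mulrC.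
Qed.

Variables (n r : nat) (a : nat -> R) (w : C -> C).

Definition moment_kernel Q z : C := Q.[z] * a_factor n a z * w z / z ^+ r.

Definition moment c Q : C := (two_pi_i R)^-1 * contour_int c (moment_kernel Q).

Lemma moment_sum c (s : seq nat) (k : nat -> C) (Q : nat -> {poly C}) :
    (forall i, contour_integrable c (moment_kernel (Q i))) ->
  moment c (\sum_(i <- s) k i *: Q i) = \sum_(i <- s) k i * moment c (Q i).
Proof.
move=> iQ; rewrite /moment (_ : moment_kernel _ =
    fun z => \sum_(i <- s) k i * moment_kernel (Q i) z); last first.
  apply/funext => z; rewrite /moment_kernel horner_sum !mulr_suml.
  by apply: eq_bigr => i _; rewrite hornerZ !mulrA.
rewrite (contour_int_sum _ k iQ).2 mulr_sumr.
by apply: eq_bigr => i _; rewrite mulrCA.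
Qed.

Lemma poly_sumX P m : (size P <= m)%N -> P = \sum_(0 <= i < m) P`_i *: 'X^i.
Proof.
move=> Pm; rewrite big_mkord -poly_def; apply/polyP => i; rewrite coef_poly.
by case: ltnP => // mi; rewrite nth_default// (leq_trans Pm).
Qed.

Definition hankel c := \matrix_(i < r, j < r) moment c 'X^(i + j).

(** The matrix of coefficients of the [p_i] is lower triangular with unit
    diagonal, and [Atilde] is the Hankel matrix multiplied by it on the left and
    by its transpose on the right. *)
Lemma det_Atilde c (p : nat -> {poly C}) :
    (forall Q, contour_integrable c (moment_kernel Q)) ->
    (forall j, p j \is monic /\ size (p j) = j.+1) ->
  \det (\matrix_(i < r, j < r) Atilde_entry n r a w p c i j) = \det (hankel c).
Proof.
move=> ic mp.
pose L := \matrix_(i < r, k < r) (p i)`_k.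
have detL : \det L = 1.
  rewrite det_trig; last first.
    apply/is_trig_mxP => i j ij; rewrite mxE nth_default//.
    by have [_ ->] := mp i.
  apply: big1 => i _; rewrite mxE; have [/monicP + sp] := mp i.
  by rewrite lead_coefE sp.
rewrite (_ : (\matrix_(i, j) _) = L *m hankel c *m L^T).
  by rewrite !det_mulmx det_tr detL mul1r mulr1.
apply/matrixP => i j.
transitivity (moment c (p i * p j)).
  rewrite mxE /Atilde_entry /moment; congr (_ * contour_int c _).
  by apply/funext => z; rewrite /moment_kernel hornerM.
have szp (m : 'I_r) : (size (p m) <= r)%N by have [_ ->] := mp m.
have -> : p i * p j = \sum_(0 <= k < r) (p i)`_k *: ('X^k * p j).
  rewrite {1}(poly_sumX (szp i)) mulr_suml.
  by apply: eq_bigr => k _; rewrite scalerAl.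
rewrite moment_sum// big_mkord -mulmxA mxE; apply: eq_bigr => k _.
rewrite [L _ _]mxE; congr (_ * _).
have -> : 'X^k * p j = \sum_(0 <= l < r) (p j)`_l *: 'X^(k + l).
  rewrite {1}(poly_sumX (szp j)) mulr_sumr.
  by apply: eq_bigr => l _; rewrite -scalerAr -exprD.
rewrite moment_sum// big_mkord mxE; apply: eq_bigr => l _.
by rewrite !mxE mulrC.
Qed.

(** [A(i - j)] is minus the moment of [z ^ (i + (r - 1 - j))]: the Toeplitz
    matrix is minus the Hankel matrix with its columns reversed. *)
Lemma det_A c : avoids c 0 ->
  \det (\matrix_(i < r, j < r) A_entry n a w c (i%:Z - j%:Z))
    = (-1) ^+ (r * r.+1)./2 * \det (hankel c).
Proof.
move=> c0.
rewrite (_ : (\matrix_(i, j) _) = (-1) *: col_perm (rev_perm r) (hankel c)).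
  rewrite detZ col_permE det_mulmx det_perm odd_permV -sign_rev_perm.
  by rewrite [\det _ * _]mulrC mulrA.
apply/matrixP => i j; rewrite !mxE permE /A_entry /moment [RHS]mulrA.
congr (_ * _); apply: eq_contour_int => u u01.
rewrite /moment_kernel hornerXn; move: (c u) (c0 u u01) => z z0.
have zr : z ^+ r = z ^+ (r - j.+1) * (z * z ^+ j).
  by rewrite -exprS -exprD subnK.
have zij : z ^ (i%:Z - j%:Z) = z ^+ i / z ^+ j by rewrite expfzDr// exprnN.
have rj0 : z ^+ (r - j.+1) != 0 by rewrite expf_neq0.
have j0 : z ^+ j != 0 by rewrite expf_neq0.
rewrite zij zr exprD /=.
move: (z ^+ i) (z ^+ j) (z ^+ (r - j.+1)) (a_factor n a z) (w z) rj0 j0.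
by move=> zi zj zr' az wz rj0 j0; field; rewrite z0 rj0 j0.
Qed.

(** The discriminant expands over pairs of permutations [(s, t)] into products
    of [z_k ^ (s k + t k)], and the integral of each product factors into
    moments. *)
Lemma lln_expand c (cs : seq (R -> C)) : size cs = r ->
    (forall k Q, (k < r)%N ->
      contour_integrable (nth (fun=> 0) cs k) (moment_kernel Q) /\
      contour_int (nth (fun=> 0) cs k) (moment_kernel Q)
        = contour_int c (moment_kernel Q)) ->
  iter_contour_int cs (lln_integrand n r a w)
    = (-1) ^+ (r * r.+1)./2 * \det (hankel c).
Proof.
move=> sz same.
pose d : C := (-1) ^+ (r * r.+1)./2 / (r`!%:R * two_pi_i R ^+ r).
(* The exponent of the m-th variable; only indices m < r occur. *)
pose e (st : 'S_r * 'S_r) m :=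
  if insub m is Some k then (st.1 k + st.2 k)%N else 0%N.
rewrite (@iter_contour_int_sum _ cs
    (fun st : 'S_r * 'S_r => d * ((-1) ^+ st.1 * (-1) ^+ st.2))
    (fun st m => moment_kernel 'X^(e st m))).
- rewrite sz.
  pose H := \matrix_(i < r, j < r) contour_int c (moment_kernel 'X^(i + j)).
  transitivity (d * (r`!%:R * \det H)).
    rewrite -sum_perm_pair big_distrr /=; apply: eq_bigr => st _.
    rewrite [RHS]mulrA; congr (_ * _); apply: eq_bigr => k _.
    rewrite mxE /e valK.
    by have [_ ->] := same k 'X^(st.1 k + st.2 k) (ltn_ord k).
  rewrite (_ : hankel c = (two_pi_i R)^-1 *: H); last first.
    by apply/matrixP => i j; rewrite !mxE.
  rewrite detZ /d exprVn.
  have f0 : r`!%:R != 0 :> C by rewrite pnatr_eq0 -lt0n fact_gt0.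
  have t0 : two_pi_i R ^+ r != 0 by rewrite expf_neq0// two_pi_i_neq0.
  by move: (\det _) t0 => D t0; field; rewrite f0 t0.
- move=> zs; rewrite sz => szs; rewrite /lln_integrand sqr_Vandermonde_expand.
  rewrite big_distrr /= !big_distrl /=; apply: eq_bigr => st _.
  rewrite !invfM -prodfV.
  transitivity (d * ((-1) ^+ st.1 * (-1) ^+ st.2) *
    ((\prod_(k < r) (zs`_k ^+ st.1 k * zs`_k ^+ st.2 k)) *
      (\prod_(k < r) (a_factor n a zs`_k * w zs`_k)) *
      (\prod_(k < r) (zs`_k ^+ r)^-1))).
    rewrite /d invfM.
    move: (\prod_(k < r) (zs`_k ^+ st.1 k * zs`_k ^+ st.2 k)) => Z.
    move: (\prod_(k < r) (a_factor n a zs`_k * w zs`_k)) => W.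
    move: (\prod_(k < r) (zs`_k ^+ r)^-1) (r`!%:R^-1 : C) (two_pi_i R ^- r)
      => V f p.
    move: ((-1) ^+ st.1 : C) ((-1) ^+ st.2 : C) ((-1) ^+ (r * r.+1)./2 : C)
      => s t g.
    ring.
  rewrite -!big_split /=; congr (_ * _); apply: eq_bigr => k _.
  by rewrite /e valK /moment_kernel hornerXn exprD !mulrA.
- by move=> st m; rewrite sz => mr; have [] := same m 'X^(e st m) mr.
Qed.

End Moments.

(** * The limits as determinants *)

Section Assembly.
Local Open Scope classical_set_scope.
Local Open Scope ring_scope.
Variable R : realType.
Local Notation C := R[i].
Implicit Types (c d : R -> C) (Q W : {poly C}).

(** This form covers both weights: [tau = 0] for the alpha case, [W = 1] for the
    Plancherel case. *)
Definition exp_poly (w : C -> C) := exists (W : {poly C}) (tau : R),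
  forall z, w z = W.[z] * cexp (- (tau%:C%C * z)).

Lemma w_alpha_exp_poly (t : nat) (alpha : nat -> R) :
  exp_poly (w_alpha t alpha).
Proof.
exists (\prod_(1 <= m < t.+1) (1 - (alpha m)%:C%C *: 'X)), 0 => z.
rewrite mul0r oppr0 cexp0 mulr1 horner_prod; apply: eq_bigr => m _.
by rewrite !hornerE.
Qed.

Lemma w_plancherel_exp_poly (tau : R) : exp_poly (w_plancherel tau).
Proof. by exists 1, tau => z; rewrite hornerC mul1r. Qed.

Lemma kernel_rational n r (a : nat -> R) (w : C -> C) W (tau : R) Q z :
    (forall z, w z = W.[z] * cexp (- (tau%:C%C * z))) ->
  moment_kernel n r a w Q z = cexp (- (tau%:C%C * z)) *
    ((Q * W * (\prod_(1 <= l < n.+1) - (a l)%:C%C)%:P).[z]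
     * \prod_(p <- [seq (a l)%:C%C | l <- index_iota 1 n.+1] ++ nseq r 0)
         (z - p)^-1).
Proof.
move=> ww; rewrite /moment_kernel ww !hornerM hornerC big_cat big_map /=.
have -> : \prod_(p <- nseq r 0) (z - p)^-1 = (z ^+ r)^-1.
  rewrite big_nseq; elim: r => [|r IH]; first by rewrite invr1.
  by rewrite iterS IH exprS invfM subr0.
have -> : a_factor n a z = (\prod_(1 <= l < n.+1) - (a l)%:C%C)
    * \prod_(1 <= l < n.+1) (z - (a l)%:C%C)^-1.
  rewrite -big_split; apply: eq_bigr => l _ /=.
  by rewrite -opprB invrN mulrN mulNr.
move: (\prod_(1 <= l < n.+1) - (a l)%:C%C) => A.
move: (\prod_(1 <= l < n.+1) (z - (a l)%:C%C)^-1) (cexp _) (z ^- r) => B e V.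
by move: (Q.[z]) (W.[z]) => q v; ring.
Qed.

Lemma same_contour_int_kernel n r (a : nat -> R) (w : C -> C) Q c d :
  exp_poly w -> ccw_loop_around n a c -> ccw_loop_around n a d ->
  same_contour_int c d (moment_kernel n r a w Q).
Proof.
move=> [W [tau ww]] [[pc c01 _] wc [c0 wc0]] [[pd d01 _] wd [d0 wd0]].
rewrite (funext (fun z => kernel_rational n r a Q z ww)).
apply: (same_contour_int_pfrac pc pd c01 d01); apply: pfrac_rational => p.
rewrite mem_cat mem_nseq => /orP[/mapP[l]|/andP[_ /eqP ->]].
  rewrite mem_index_iota ltnS => ln ->.
  have [ac e1] := wc l ln; have [ad e2] := wd l ln.
  by split; [exact: ac|exact: ad|rewrite e1 e2].
by split; [exact: c0|exact: d0|rewrite wc0 wd0].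
Qed.

Lemma ccw_loop_around_le n N (a : nat -> R) c : (n <= N)%N ->
  ccw_loop_around N a c -> ccw_loop_around n a c.
Proof.
move=> nN [lc wc c0]; split=> // l /andP[l1 ln].
by apply: wc; rewrite l1 (leq_trans ln).
Qed.

Lemma lln_determinants N (a : nat -> R) (w : C -> C) (x : nat -> nat -> R) :
    exp_poly w -> lln_limits N a w x ->
    forall n r, (1 <= r <= n)%N -> (n <= N)%N ->
    forall c, ccw_loop_around N a c ->
    forall p : nat -> {poly C},
      (forall j, p j \is monic /\ size (p j) = j.+1) ->
  (expR (- top_sum x n r))%:C%C
    = \det (\matrix_(i < r, j < r) A_entry n a w c (i%:Z - j%:Z)) /\
  \det (\matrix_(i < r, j < r) A_entry n a w c (i%:Z - j%:Z))
    = (-1) ^+ (r * r.+1)./2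
      * \det (\matrix_(i < r, j < r) Atilde_entry n r a w p c i j).
Proof.
move=> ew hx n r rn nN c hc p mp.
have {}hc := ccw_loop_around_le nN hc.
have [c0 _] : avoids c 0 /\ winding_number c 0 = 0 by case: hc.
have ic Q : contour_integrable c (moment_kernel n r a w Q).
  by have [] := same_contour_int_kernel r Q ew hc hc.
rewrite (det_A n r a w c0) (det_Atilde ic mp); split; last by [].
have [cs [scs hcs ->]] := hx n r rn nN.
apply: lln_expand scs _ => k Q kr.
have [ik _ e] := same_contour_int_kernel r Q ew (hcs k kr) hc.
by split; [exact: ik|exact: e].
Qed.

End Assembly.
Theorem lemma3p2 (R : realType) (N : nat) (a : nat -> R)
    (hN : (1 <= N)%N)
    (ha : forall l, (1 <= l <= N)%N -> 0 < a l) :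
  (forall (t : nat) (alpha : nat -> R) (x : nat -> nat -> R),
     (forall m, (1 <= m <= t)%N -> 0 < alpha m) ->
     (forall i j, (1 <= i <= N)%N -> (1 <= j <= t)%N -> a i * alpha j < 1) ->
     lln_limits N a (w_alpha t alpha) x ->
     forall n r, (1 <= r <= n)%N -> (n <= N)%N ->
     forall c : R -> R[i], ccw_loop_around N a c ->
     forall p : nat -> {poly R[i]},
       (forall j, p j \is monic /\ size (p j) = j.+1) ->
       (expR (- top_sum x n r))%:C%C
         = \det (\matrix_(i < r, j < r)
                   A_entry n a (w_alpha t alpha) c (i%:Z - j%:Z))
       /\
       \det (\matrix_(i < r, j < r)
               A_entry n a (w_alpha t alpha) c (i%:Z - j%:Z))
         = (-1) ^+ (r * r.+1)./2
           * \det (\matrix_(i < r, j < r)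
                     Atilde_entry n r a (w_alpha t alpha) p c i j))
  /\
  (forall (tau : R) (x : nat -> nat -> R),
     0 < tau ->
     lln_limits N a (w_plancherel tau) x ->
     forall n r, (1 <= r <= n)%N -> (n <= N)%N ->
     forall c : R -> R[i], ccw_loop_around N a c ->
     forall p : nat -> {poly R[i]},
       (forall j, p j \is monic /\ size (p j) = j.+1) ->
       (expR (- top_sum x n r))%:C%C
         = \det (\matrix_(i < r, j < r)
                   A_entry n a (w_plancherel tau) c (i%:Z - j%:Z))
       /\
       \det (\matrix_(i < r, j < r)
               A_entry n a (w_plancherel tau) c (i%:Z - j%:Z))
         = (-1) ^+ (r * r.+1)./2
           * \det (\matrix_(i < r, j < r)
                     Atilde_entry n r a (w_plancherel tau) p c i j)).
Proof.
split=> [t alpha x _ _ hx|tau x _ hx].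
  exact: (lln_determinants (w_alpha_exp_poly t alpha) hx).
exact: (lln_determinants (w_plancherel_exp_poly tau) hx).
Qed.
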